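(* Let $K\subseteq\mathbb{R}^n$ be a nonempty closed set, $N\in\mathbb{N}$, and let $f_1,\ldots,f_N:K\to\overline{\mathbb{R}}$ be proper lower semicontinuous functions. Put $f:=\sum_{i=1}^N f_i$. Let $(r_k)_{k\in\mathbb{N}_0}$ be a sequence of random variables on the probability space $(\Sigma,\mathcal{A},\mathbb{P})$ described in the context, taking values in $\{1,\ldots,N\}$, sampled according to the uniform distribution and independently at each step. Let $x_0\in\mathbb{R}^n$, let $(\beta_k)_{k\in\mathbb{N}_0}$ be a sequence of positive real numbers satisfying $$\sum_{k=0}^{\infty}\beta_k=+\infty,\qquad \sum_{k=0}^{\infty}\beta_k^2<+\infty,$$ and let $(x_k)_{k\in\mathbb{N}_0}$ be defined recursively by $$x_{k+1}\in\mathrm{Prox}_{\beta_k f_{r_k}}(K,x_k),\qquad k\in\mathbb{N}_0.$$ If $\operatorname{argmin}_K f\neq\emptyset$ and the functions $f_1,\ldots,f_N$ are Lipschitz continuous and prox-convex on $K$ with modulus $\alpha$, then, with probability $1$, the sequence $(x_k)$ converges to a minimizer of $f$ (on $K$).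
   Context: $\mathbb{R}^n$ carries the Euclidean inner product $\langle\cdot,\cdot\rangle$ and norm $\|\cdot\|$; $\overline{\mathbb{R}}=\mathbb{R}\cup\{\pm\infty\}$; $\mathbb{N}_0=\{0,1,2,\ldots\}$. A function $h:K\to\overline{\mathbb{R}}$ is proper if it never takes the value $-\infty$ and $\mathrm{dom}\,h:=\{x\in K: h(x)<+\infty\}$ is nonempty. $\operatorname{argmin}_K f$ is the set of all minimal points of $f$ in $K$. $\Sigma$ is the space of infinite sequences with entries in $\{1,\ldots,N\}$, $\mathcal{A}$ is the product $\sigma$-algebra, and $\mathbb{P}$ is the product of the uniform measures on $\{1,\ldots,N\}$. For $\beta>0$ and $z\in\mathbb{R}^n$, $$\mathrm{Prox}_{\beta h}(K,z):=\operatorname{argmin}_{y\in K}\left\{h(y)+\frac{1}{2\beta}\|y-z\|^2\right\}.$$ Prox-convexity: let $K$ be closed, $h$ proper with $K\cap\mathrm{dom}\,h\neq\emptyset$, and $\beta>0$. Then $h$ is prox-convex on $K$ if there exists $\alpha>0$ such that for every $z\in K$, $\mathrm{Prox}_{\beta h}(K,z)\neq\emptyset$, and $$\bar x\in\mathrm{Prox}_{\beta h}(K,z)\ \Longrightarrow\ h(\bar x)-h(x)\le\frac{\alpha}{\beta}\langle\bar x-z,x-\bar x\rangle\quad\text{for all }x\in K.$$ The scalar $\alpha$ is called the prox-convex value, or modulus, of $h$ on $K$. *)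

(* Defs.v *)
From HB Require Import structures.
From mathcomp Require Import all_boot all_order all_algebra.
From mathcomp Require Import all_classical all_reals all_analysis.

Set Implicit Arguments.
Unset Strict Implicit.
Unset Printing Implicit Defensive.

Import Order.TTheory GRing.Theory Num.Theory.
Import numFieldNormedType.Exports.

Local Open Scope classical_set_scope.
Local Open Scope ring_scope.

(* The library norm on 'rV[R]_n is the sup norm, hence the explicit Euclidean
   structure; the topology is the same. *)
Definition edot (R : realType) (n : nat) (x y : 'rV[R]_n) : R :=
  \sum_(i < n) x 0 i * y 0 i.

Definition enorm (R : realType) (n : nat) (x : 'rV[R]_n) : R :=
  Num.sqrt (edot x x).

(* A function K -> \bar R is represented by a function on the whole of
   'rV[R]_n of which only the values on K are ever used. *)
Section FunctionsOnK.
Context (R : realType) (n : nat) (K : set 'rV[R]_n).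
Local Open Scope ereal_scope.

Definition proper_on (h : 'rV[R]_n -> \bar R) : Prop :=
  (forall x, K x -> h x != -oo) /\ (exists x, K x /\ h x < +oo).

(* The subspace topology makes this lower semicontinuity relative to K: the
   points outside K are isolated in [subspace K]. *)
Definition lsc_on (h : 'rV[R]_n -> \bar R) : Prop :=
  lower_semicontinuous (h : subspace K -> \bar R).

(* Since `|+oo - +oo| = +oo in \bar R, taking y = x shows that h is
   real-valued on K. *)
Definition lipschitz_continuous_on (h : 'rV[R]_n -> \bar R) : Prop :=
  exists L : R, forall x y, K x -> K y ->
    `|h x - h y| <= (L * enorm (x - y))%:E.

Definition argmin (h : 'rV[R]_n -> \bar R) : set 'rV[R]_n :=
  [set x | K x /\ forall y, K y -> h x <= h y].

Definition Prox (beta : R) (h : 'rV[R]_n -> \bar R) (z : 'rV[R]_n) :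
    set 'rV[R]_n :=
  argmin (fun y => h y + ((2 * beta)^-1 * enorm (y - z) ^+ 2)%:E).

(* Prox-convexity depends on the proximal parameter beta. *)
Definition prox_convex_with (beta alpha : R) (h : 'rV[R]_n -> \bar R) : Prop :=
  [/\ (0 < alpha)%R,
      forall z, K z -> Prox beta h z !=set0 &
      forall z xbar, K z -> Prox beta h z xbar ->
        forall x, K x ->
          h xbar - h x <= (alpha / beta * edot (xbar - z) (x - xbar))%:E].

End FunctionsOnK.

Arguments proper_on {R n} K h.
Arguments lsc_on {R n} K h.
Arguments lipschitz_continuous_on {R n} K h.
Arguments argmin {R n} K h.
Arguments Prox {R n} K beta h z.
Arguments prox_convex_with {R n} K beta alpha h.

(* {1, ..., N} is 'I_N for N >= 1; writing N as N'.+1 makes the type pointed,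
   as the library requires of a measurable type. *)
HB.instance Definition _ (N : nat) := isPointed.Build 'I_N.+1 ord0.

HB.instance Definition _ (N : nat) := @isMeasurable.Build
  default_measure_display 'I_N.+1 discrete_measurable discrete_measurable0
  discrete_measurableC discrete_measurableU.

Definition cylinders (N : nat) : set (set (nat -> 'I_N.+1)) :=
  \bigcup_(k in [set: nat])
    preimage_set_system setT (fun w : nat -> 'I_N.+1 => w k) measurable.

Definition sequence_space (N : nat) := g_sigma_algebraType (@cylinders N).

Definition unif (R : realType) (N : nat) (A : {set 'I_N.+1}) : R :=
  #|A|%:R / N.+1%:R.

(* The defining property of the product measure: its values on measurable
   rectangles, which determine it. *)
Definition is_uniform_product (R : realType) (N : nat)
    (P : probability (sequence_space N) R) : Prop :=
  forall (m : nat) (A : nat -> {set 'I_N.+1}),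
    P [set w | forall k, (k < m)%N -> w k \in A k]
    = (\prod_(k < m) unif R (A k))%:E.

Definition uniformly_distributed (R : realType) (N : nat) (d : measure_display)
    (T : measurableType d) (P : probability T R) (X : {RV P >-> 'I_N.+1}) :
    Prop :=
  forall A : {set 'I_N.+1}, P (X @^-1` [set` A]) = (unif R A)%:E.

Definition mutually_independent (R : realType) (d d' : measure_display)
    (T : measurableType d) (T' : measurableType d') (P : probability T R)
    (X : nat -> {RV P >-> T'}) : Prop :=
  forall (J : seq nat) (A : nat -> set T'),
    uniq J -> (forall k, measurable (A k)) ->
    P (\bigcap_(k in [set` J]) X k @^-1` A k)
    = (\prod_(k <- J) P (X k @^-1` A k))%E.

(* Main.v *)
(* A proximal step of a prox-convex function is nonexpansive and satisfies
     |x_(k+1) - y|^2 <= |x_k - y|^2 - (2 beta_k / alpha) (f_(r_k) x_k - f_(r_k) y)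
                        + (L beta_k / alpha)^2
   for y in K.  Replacing f_(r_k) by the average of the f_i costs a noise term
   whose series converges almost surely: it is a martingale with summable
   variances, and since a history of k indices has only N^k values, Kolmogorov's
   maximal inequality for it is an induction on the tree of histories.  On the
   event where these series converge everything is deterministic: for every
   minimizer y the distances |x_k - y| converge, and sum beta_k (f x_k - min f)
   is finite, so that f x_k has min f as a cluster value, some cluster point of
   x_k is a minimizer, and x_k converges to it.  This holds almost surely for
   each starting point in K, hence almost surely for all starting points of a
   countable dense subset of K at once, and by nonexpansiveness for all points
   of K at once.  The latter is needed because x_0 may lie outside K, in which
   case x_1 may depend on the outcome in an arbitrary way. *)

Require Import Defs.
From mathcomp Require Import all_boot all_order all_algebra.
From mathcomp Require Import all_classical all_reals all_analysis.
From mathcomp Require Import ring lra.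

Import Order.TTheory GRing.Theory Num.Theory.
Import numFieldNormedType.Exports.

Local Open Scope classical_set_scope.
Local Open Scope ring_scope.

(** * Euclidean geometry and comparison with the sup norm *)

Section Euclidean.
Context {R : realType} {n : nat}.
Implicit Types x y z : 'rV[R]_n.

Lemma edotC x y : edot x y = edot y x.
Proof. by apply: eq_bigr => i _; rewrite mulrC. Qed.

Lemma edotBl x y z : edot (x - y) z = edot x z - edot y z.
Proof. by rewrite /edot -sumrB; apply: eq_bigr => i _; rewrite !mxE mulrBl. Qed.

Lemma edotBr x y z : edot z (x - y) = edot z x - edot z y.
Proof. by rewrite edotC edotBl !(edotC _ z). Qed.

Lemma edotZl a x y : edot (a *: x) y = a * edot x y.
Proof. by rewrite /edot mulr_sumr; apply: eq_bigr => i _; rewrite !mxE mulrA. Qed.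

Lemma edotZr a x y : edot x (a *: y) = a * edot x y.
Proof. by rewrite edotC edotZl edotC. Qed.

Lemma edot_ge0 x : 0 <= edot x x.
Proof. by apply: sumr_ge0 => i _; rewrite -expr2 sqr_ge0. Qed.

Lemma enorm_ge0 x : 0 <= enorm x.
Proof. exact: sqrtr_ge0. Qed.

Lemma enorm_sqr x : enorm x ^+ 2 = edot x x.
Proof. by rewrite sqr_sqrtr ?edot_ge0. Qed.

Lemma enormBC x y : enorm (x - y) = enorm (y - x).
Proof. by congr Num.sqrt; rewrite !edotBl !edotBr; ring. Qed.

Lemma enorm0_eq0 x : enorm x = 0 -> x = 0.
Proof.
move=> x0; have := enorm_sqr x; rewrite x0 expr0n /= => /esym e0.
apply/rowP => i; rewrite mxE; apply/eqP; rewrite -[_ == 0]orbb -mulf_eq0.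
apply/eqP; have /psumr_eq0P := e0; apply=> // j _.
by rewrite -expr2 sqr_ge0.
Qed.

(** Cauchy-Schwarz: the square of [enorm y *: x - enorm x *: y] is nonnegative, and its expansion is
    divisible by [enorm x * enorm y]. *)
Lemma edot_le x y : edot x y <= enorm x * enorm y.
Proof.
have e0 (u v : 'rV[R]_n) : enorm u = 0 -> edot u v = 0.
  by move=> /enorm0_eq0 ->; rewrite -[X in edot X _](scale0r 0) edotZl mul0r.
have [x0|x0] := eqVneq (enorm x) 0; first by rewrite e0 // x0 mul0r.
have [y0|y0] := eqVneq (enorm y) 0; first by rewrite edotC e0 // y0 mulr0.
have xy : 0 < enorm x * enorm y by rewrite mulr_gt0 // lt_def ?x0 ?y0 enorm_ge0.
have := edot_ge0 (enorm y *: x - enorm x *: y).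
rewrite !(edotBl, edotBr, edotZl, edotZr) (edotC y x) -!enorm_sqr => h.
rewrite -subr_ge0 -(pmulr_rge0 _ xy); lra.
Qed.

Lemma enorm_triangle y x z : enorm (x - z) <= enorm (x - y) + enorm (y - z).
Proof.
rewrite -ler_sqr ?nnegrE ?addr_ge0 ?enorm_ge0 //.
have := edot_le (x - y) (y - z).
have -> : enorm (x - z) ^+ 2 = enorm (x - y) ^+ 2 + enorm (y - z) ^+ 2
    + 2 * edot (x - y) (y - z).
  by rewrite !enorm_sqr !(edotBl, edotBr) (edotC y x) (edotC z x) (edotC z y); ring.
by rewrite sqrrD; lra.
Qed.

(** Turns the inner product of the prox-convexity inequality into a decrease of the squared distance
    to [x]. *)
Lemma enorm_sqr_split z b x :
  2 * edot (b - z) (x - b) =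
  enorm (z - x) ^+ 2 - enorm (b - z) ^+ 2 - enorm (b - x) ^+ 2.
Proof.
rewrite !enorm_sqr !(edotBl, edotBr) (edotC x z) (edotC b z) (edotC x b); ring.
Qed.

Lemma norm_le_enorm x : `|x| <= enorm x.
Proof.
rewrite [`|x|]mx_normrE; apply/bigmax_leP; split => [|[i j] _ /=].
  exact: enorm_ge0.
rewrite -ler_sqr ?nnegrE ?enorm_ge0 // real_normK ?num_real // enorm_sqr ord1 /edot.
by rewrite (bigD1 j) //= -expr2 lerDl; apply: sumr_ge0 => k _; rewrite -expr2 sqr_ge0.
Qed.

Lemma enorm_le_norm x : enorm x <= Num.sqrt n%:R * `|x|.
Proof.
rewrite -ler_sqr ?nnegrE ?mulr_ge0 ?sqrtr_ge0 ?enorm_ge0 // exprMn enorm_sqr.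
rewrite sqr_sqrtr ?ler0n // -[n in n%:R](card_ord n) -sumr_const mulr_suml.
apply: ler_sum => i _; rewrite mul1r -expr2 -(real_normK (num_real _)) ler_sqr ?nnegrE //.
by rewrite [`|x|]mx_normrE; apply: (le_bigmax _ _ (0, i)).
Qed.

End Euclidean.

(** * Trees of histories and the maximal inequality on them *)

Section Histories.
Context {R : realType} {N : nat}.
Local Notation I := 'I_N.+1.

(* The first [k] values of [u], the most recent one at the head. *)
Fixpoint history (u : nat -> I) (k : nat) : seq I :=
  if k is k'.+1 then u k' :: history u k' else [::].

Lemma size_history u k : size (history u k) = k.
Proof. by elim: k => //= k ->. Qed.

Context {d : measure_display} {T : measurableType d} (P : probability T R).
Context (r : nat -> T -> I).

(** The head of a history is its latest index, so the length of the tail is the time at which it was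
    drawn. *)
Fixpoint cylinder (h : seq I) : set T :=
  if h is i :: h' then r (size h') @^-1` [set i] `&` cylinder h' else setT.

Lemma cylinder_history w k : cylinder (history (r^~ w) k) w.
Proof. by elim: k => //= k IH; split => //; rewrite size_history. Qed.

Lemma bigsetU_ordP (F : I -> set T) w :
  (\big[setU/set0]_(i < N.+1) F i) w <-> exists i, F i w.
Proof.
rewrite -bigcup_seq; split => [[i _ Fi]|[i Fi]]; first by exists i.
by exists i => //=; rewrite mem_index_enum.
Qed.

Section Exceed.
Variables (g : seq I -> I -> R) (e : R).

(* The outcomes in [cylinder h] for which the partial sums of [g] along the
   next [t] indices, started at [s], leave the interval ]-e, e[. *)
Fixpoint exceed (t : nat) (h : seq I) (s : R) : set T :=
  if e <= `|s| then cylinder h else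
  if t is t'.+1 then
    \big[setU/set0]_(i < N.+1) exceed t' (i :: h) (s + g h i)
  else set0.

Lemma exceedS t h s : exceed t h s `<=` exceed t.+1 h s.
Proof.
elim: t h s => [|t IH] h s w; first by rewrite /=; case: ifP.
rewrite [exceed t.+1 _ _]/= [exceed t.+2 _ _]/=; case: ifP => // _.
by move=> /bigsetU_ordP[i ei]; apply/bigsetU_ordP; exists i; exact: IH.
Qed.

(** By induction on [t]: either the starting value is already outside the interval, or the first
    increment is absorbed into it. *)
Lemma exceedP t m s w j :
  (m <= j <= m + t)%N ->
  e <= `|s + \sum_(m <= l < j) g (history (r^~ w) l) (r l w)| ->
  exceed t (history (r^~ w) m) s w.
Proof.
elim: t m s => [|t IH] m s /andP[mj jm].
  rewrite addn0 in jm; rewrite big_geq // addr0 /= => ->.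
  exact: cylinder_history.
have [es _|es] := boolP (e <= `|s|).
  by rewrite /= es; exact: cylinder_history.
move: mj; rewrite leq_eqVlt => /orP[/eqP <-|mj].
  by rewrite big_geq // addr0 (negbTE es).
rewrite big_ltn // addrA => H; rewrite /= (negbTE es).
apply/bigsetU_ordP; exists (r m w).
by apply: (IH m.+1) => //; rewrite mj addSnnS.
Qed.

Hypothesis r_measurable : forall k i, measurable (r k @^-1` [set i]).

Lemma measurable_cylinder h : measurable (cylinder h).
Proof. by elim: h => //= i h IH; exact: measurableI. Qed.

Lemma measurable_exceed t h s : measurable (exceed t h s).
Proof.
elim: t h s => [|t IH] h s /=; case: ifP => // _; do ?exact: measurable_cylinder.
by apply: bigsetU_measurable => i _; exact: IH.
Qed.

(** Independence and uniformity of the indices enter through this bound alone. *)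
Hypothesis cylinder_le : forall h, (P (cylinder h) <= (N.+1%:R ^- size h)%:E)%E.

Lemma Boole_ord (F : I -> set T) : (forall i, measurable (F i)) ->
  (P (\big[setU/set0]_(i < N.+1) F i) <= \sum_(i < N.+1) P (F i))%E.
Proof.
move=> mF; pose A n : set T := F (inord n).
have -> : \big[setU/set0]_(i < N.+1) F i = \big[setU/set0]_(i < N.+1) A i.
  by apply: eq_bigr => i _; rewrite /A inord_val.
apply: (le_trans (Boole_inequality P _)); first by move=> i _; exact: mF.
by apply: lee_sum => i _; rewrite /A inord_val.
Qed.

(* Kolmogorov's maximal inequality; the value [W h] bounds the expected sum of
   the squares of the increments to come after the history [h]. *)
Lemma exceed_le (W : seq I -> R) t h s : 0 < e ->
  (forall h, 0 <= W h) ->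
  (forall h, \sum_(i < N.+1) g h i = 0) ->
  (forall h, \sum_(i < N.+1) (g h i ^+ 2 + W (i :: h)) <= N.+1%:R * W h) ->
  (P (exceed t h s) <=
     (N.+1%:R ^- size h * ((s ^+ 2 + W h) / e ^+ 2))%:E)%E.
Proof.
move=> e0 W0 g0 gW; have ee0 : 0 < e ^+ 2 by rewrite exprn_gt0.
have N0 k : 0 < N.+1%:R ^- k :> R by rewrite invr_gt0 exprn_gt0.
have pos h' s' : 0 <= N.+1%:R ^- size h' * ((s' ^+ 2 + W h') / e ^+ 2).
  by rewrite mulr_ge0 ?divr_ge0 ?addr_ge0 ?sqr_ge0 ?W0 // ltW.
(* Once the interval is left, the fraction is at least [1] and the bound on the cylinder
   suffices. *)
have base h' s' : e <= `|s'| -> (P (cylinder h') <=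
     (N.+1%:R ^- size h' * ((s' ^+ 2 + W h') / e ^+ 2))%:E)%E.
  move=> es; apply: (le_trans (cylinder_le h')).
  rewrite lee_fin ler_pMr // ler_pdivlMr // mul1r.
  rewrite (le_trans (_ : _ <= s' ^+ 2)) ?lerDl // -[leRHS](real_normK (num_real _)).
  by rewrite ler_sqr ?nnegrE // ltW.
elim: t h s => [|t IH] h s /=; case: ifP => [/base//|_].
  by rewrite measure0 lee_fin pos.
apply: (le_trans (Boole_ord _ _)); first by move=> i; exact: measurable_exceed.
apply: (@le_trans _ _ (\sum_(i < N.+1) (N.+1%:R ^- (size h).+1 *
    (((s + g h i) ^+ 2 + W (i :: h)) / e ^+ 2))%:E)%E).
  by apply: lee_sum => i _; exact: IH.
rewrite sumEFin lee_fin -mulr_sumr -mulr_suml.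
rewrite exprS invfM [X in X * _]mulrC -mulrA ler_pM2l // mulrA ler_pM2r ?invr_gt0 //.
rewrite ler_pdivrMl ?ltr0n //.
(* After expansion of the squares, the cross terms [2 * s * g h i] sum to zero by [g0]. *)
have -> : \sum_(i < N.+1) ((s + g h i) ^+ 2 + W (i :: h)) =
   N.+1%:R * s ^+ 2 + \sum_(i < N.+1) (g h i ^+ 2 + W (i :: h)).
  rewrite (eq_bigr (fun i => s ^+ 2 + (2 * s) * g h i + (g h i ^+ 2 + W (i :: h)))).
    rewrite 2!big_split /= -[X in _ + X + _]mulr_sumr g0 mulr0 addr0.
    by rewrite sumr_const card_ord mulr_natl.
  by move=> i _; ring.
by rewrite mulrDr lerD2l gW.
Qed.

End Exceed.

End Histories.

(** * Remainders of square-summable series and almost sure convergence of martingales *)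

Section SquareSummable.
Context {R : realType}.
Variable b : nat -> R.
Hypothesis b2 : cvgn (series (fun k => b k ^+ 2)).

Definition tail2 k : R :=
  limn (series (fun k => b k ^+ 2)) - series (fun k => b k ^+ 2) k.

Lemma tail2S k : tail2 k.+1 + b k ^+ 2 = tail2 k.
Proof. by rewrite /tail2 [series _ k.+1]seriesSr; ring. Qed.

Lemma tail2_ge0 k : 0 <= tail2 k.
Proof.
rewrite subr_ge0; apply: nondecreasing_cvgn_le => //.
by apply: nondecreasing_series => i _ _; exact: sqr_ge0.
Qed.

Lemma tail2_cvg0 : tail2 k @[k --> \oo] --> (0 : R).
Proof.
rewrite -[X in _ --> X](subrr (limn (series (fun k => b k ^+ 2)))).
by apply: cvgB => //; exact: cvg_cst.
Qed.

End SquareSummable.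

Lemma is_cvgn_near {R : realType} (u : nat -> R) :
  (forall e, 0 < e -> exists m, forall j, (m <= j)%N -> `|u j - u m| < e) ->
  cvgn u.
Proof.
move=> H; apply/cauchy_cvgP/cauchy_exP => e /H[m um].
exists (u m), m => // j /= mj.
by rewrite /ball /= distrC um.
Qed.

Section MartingaleConvergence.
Context {R : realType} {N : nat}.
Local Notation I := 'I_N.+1.
Context {d : measure_display} {T : measurableType d} (P : probability T R).
Variable r : nat -> T -> I.
Hypothesis r_measurable : forall k i, measurable (r k @^-1` [set i]).
Hypothesis cylinder_le :
  forall h, (P (cylinder r h) <= (N.+1%:R ^- size h)%:E)%E.

(* [g] is a martingale difference sequence, and the hypotheses on [D] bound its
   variances by a multiple of [b k ^+ 2]. *)
Lemma martingale_cvg (b : nat -> R) (g : seq I -> I -> R) (D : seq I -> R)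
    (c : R) :
  cvgn (series (fun k => b k ^+ 2)) -> 0 <= c ->
  (forall h, 0 <= D h) ->
  (forall h, \sum_(i < N.+1) D (i :: h) <=
     N.+1%:R * (D h + c * b (size h) ^+ 2)) ->
  (forall h i, g h i ^+ 2 <= b (size h) ^+ 2 * D h) ->
  (forall h, \sum_(i < N.+1) g h i = 0) ->
  {ae P, forall w, cvgn (series (fun k => g (history (r^~ w) k) (r k w)))}.
Proof.
move=> b2 c0 D0 DS gD g0.
(* Suppressing the increments before time [m] lets [exceed], started at the root, control the
   partial sums from [m] on. *)
pose g' m h i := if (size h < m)%N then 0 else g h i.
(* The first factor bounds the conditional mean of [D] at all times after [h]; the second sums the
   weights [b k ^+ 2] of the increments still to come. *)
pose W m h := (D h + c * tail2 b (size h)) * tail2 b (maxn (size h) m).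
have t0 := tail2_ge0 b b2.
have W0 m h : 0 <= W m h.
  by apply: mulr_ge0 => //; apply: addr_ge0 => //; exact: mulr_ge0.
have g'0 m h : \sum_(i < N.+1) g' m h i = 0.
  by rewrite /g'; case: (size h < m)%N => //; rewrite big1.
have g'W m h :
    \sum_(i < N.+1) (g' m h i ^+ 2 + W m (i :: h)) <= N.+1%:R * W m h.
  set k := size h.
  have WS : \sum_(i < N.+1) W m (i :: h) <=
      N.+1%:R * ((D h + c * tail2 b k) * tail2 b (maxn k.+1 m)).
    rewrite /W /= -/k -mulr_suml mulrA ler_wpM2r ?t0 // big_split /= sumr_const card_ord.
    rewrite -[(c * _) *+ _]mulr_natl -(tail2S b k).
    by have := DS h; rewrite -/k; lra.
  rewrite big_split /=; apply: (le_trans (lerD (lexx _) WS)).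
  rewrite /W -/k -lerBrDr -mulrBr -mulrBr.
  (* The two tails differ only from time [m] on, and then by [b k ^+ 2], which pays for the
     increment. *)
  have [km|mk] := ltnP k m.
    rewrite (maxn_idPr km) subrr !mulr0.
    by rewrite big1 // => i _; rewrite /g' -/k km expr0n.
  rewrite (maxn_idPl (leqW mk)) -(tail2S b k).
  apply: (@le_trans _ _ (\sum_(i < N.+1) (D h + c * tail2 b k) * b k ^+ 2)).
    apply: ler_sum => i _; rewrite /g' -/k ltnNge mk /=.
    apply: (le_trans (gD h i)); rewrite mulrC ler_wpM2r ?sqr_ge0 //.
    by rewrite lerDl mulr_ge0 ?t0.
  rewrite sumr_const card_ord -mulr_natl le_eqVlt -(tail2S b k).
  by apply/orP; left; apply/eqP; ring.
pose G m e := \bigcup_t exceed r (g' m) e t [::] 0.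
have mG m e : measurable (G m e).
  by apply: bigcup_measurable => t _; exact: measurable_exceed.
have PG m e : 0 < e -> (P (G m e) <= (W m [::] / e ^+ 2)%:E)%E.
  move=> e0.
  have GS : nondecreasing_seq (fun t => exceed r (g' m) e t [::] 0).
    by apply/nondecreasing_seqP => t; apply/subsetPset; exact: exceedS.
  have cG : P (exceed r (g' m) e t [::] 0) @[t --> \oo] --> P (G m e).
    apply: nondecreasing_cvg_mu => //; last exact: mG.
    by move=> t; exact: measurable_exceed.
  rewrite -(cvg_lim _ cG) //; apply: lime_le.
    by apply/cvg_ex; eexists; exact: cG.
  near=> t; apply: le_trans.
    exact: (exceed_le P r (g' m) e r_measurable cylinder_le (W m)).
  by rewrite /= expr0n /= expr0 invr1 mul1r add0r.
have nG e : 0 < e -> P.-negligible (\bigcap_m G m e).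
  move=> e0; apply/negligibleP; first exact: bigcap_measurableType.
  apply/eqP; rewrite eq_le measure_ge0 andbT.
  (* [W m [::]] is a constant times [tail2 b m], so the bounds on the probabilities of [G m e]
     vanish as [m] grows. *)
  have cW : (W m [::] / e ^+ 2)%:E @[m --> \oo] --> 0%:E.
    apply: cvg_EFin; first by apply: nearW.
    rewrite -(mul0r (e ^+ 2)^-1); apply: cvgM; last exact: cvg_cst.
    rewrite -(mulr0 (D [::] + c * tail2 b 0)); apply: cvgM; first exact: cvg_cst.
    under eq_fun do rewrite /= max0n.
    exact: tail2_cvg0.
  rewrite -[X in (_ <= X)%E](cvg_lim _ cW) //; apply: lime_ge.
    by apply/cvg_ex; eexists; exact: cW.
  near=> m; apply: le_trans (PG m e e0).
  apply: le_measure; rewrite ?inE //; first exact: bigcap_measurableType.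
  exact: bigcap_inf.
(* Outside this null set, for each [p] some [m] has all later partial sums within [p.+1%:R^-1] of
   the one at [m], so they form a Cauchy sequence. *)
have : P.-negligible (\bigcup_p \bigcap_m G m p.+1%:R^-1).
  by apply: negligible_bigcup => p; apply: nG; rewrite invr_gt0 ltr0n.
apply: negligibleS => w /= ncvg; apply: contrapT => nw; apply: ncvg.
apply: is_cvgn_near => e e0.
have [p pe] : exists p, p.+1%:R^-1 < e.
  by have [p _ /(_ p (leqnn p))] := near_infty_natSinv_lt (PosNum e0); exists p.
have [m nGm] : exists m, ~ G m p.+1%:R^-1 w.
  apply: contrapT => /forallNP nm; apply: nw; exists p => // m _.
  by apply: contrapT; exact: nm.
exists m => j mj; apply: lt_trans pe; rewrite ltNge; apply/negP => H; apply: nGm.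
exists j => //; apply: (exceedP r (g' m) _ j 0 0 w j); first by rewrite add0n leqnn.
rewrite add0r (@big_cat_nat _ _ _ m) //= big_nat_cond big1 ?add0r; last first.
  by move=> i /andP[/andP[_ im] _]; rewrite /g' size_history im.
suff -> : \sum_(m <= i < j) g' m (history (r^~ w) i) (r i w) =
  series (fun k => g (history (r^~ w) k) (r k w)) j -
  series (fun k => g (history (r^~ w) k) (r k w)) m by [].
rewrite sub_series_geq //; apply: eq_big_nat => i /andP[mi _].
by rewrite /g' size_history ltnNge mi.
Unshelve. all: by end_near. Qed.

End MartingaleConvergence.

(** * Convergence criteria for real sequences and series *)

Section RealSeries.
Context {R : realType}.
Implicit Types (a b d u : nat -> R).

Lemma is_cvg_series_sum (I : finType) (c : I -> R) (s : I -> nat -> R) :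
  (forall i, cvgn (series (s i))) ->
  cvgn (series (fun k => \sum_i c i * s i k)).
Proof.
move=> cs; rewrite (_ : (fun k => _) = \sum_i c i *: s i); last first.
  by apply/funext => k; rewrite fct_sumE.
elim/big_ind: _ => [|f g cf cg|i _].
- rewrite /series /= (_ : (fun n => _) = cst 0); first exact: is_cvg_cst.
  by apply/funext => k; rewrite big1.
- exact: is_cvg_seriesD.
- exact: is_cvg_seriesZ.
Qed.

Lemma is_cvg_series_dominated a b C m :
  cvgn (series a) -> (forall k, 0 <= a k) -> (forall k, 0 <= b k) -> 0 <= C ->
  (forall k, (m <= k)%N -> b k <= C * a k) -> cvgn (series b).
Proof.
move=> ca a0 b0 C0 ba; rewrite -(is_cvg_series_restrict m).
apply: nondecreasing_is_cvgn.
  apply/nondecreasing_seqP => k /=; have [mk|km] := leqP m k.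
    by rewrite big_nat_recr //= lerDl.
  by rewrite !big_geq // ltnW.
exists (C * limn (series a)) => _ [k _ <-] /=.
apply: (@le_trans _ _ (C * series a k)).
  have [mk|km] := leqP m k; last first.
    by rewrite big_geq ?(ltnW km) // mulr_ge0 ?sumr_ge0.
  rewrite [series a k](@big_cat_nat _ _ _ m) //= mulrDr mulr_sumr mulr_sumr.
  rewrite -[leLHS]add0r lerD ?sumr_ge0 // => [i _|]; first exact: mulr_ge0.
  by rewrite ler_sum_nat // => i /andP[mi _]; exact: ba.
rewrite ler_wpM2l // nondecreasing_cvgn_le //.
by apply: nondecreasing_series => i _ _.
Qed.

(** The sequence [d + series a - series u] is nonincreasing and bounded below. The errors [u] may
    change sign, so their series may converge only conditionally. *)
Lemma almost_decreasing_cvg d a u :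
  (forall k, 0 <= d k) -> (forall k, 0 <= a k) ->
  (forall k, d k.+1 <= d k - a k + u k) -> cvgn (series u) ->
  cvgn d /\ cvgn (series a).
Proof.
move=> d0 a0 du cu.
have [M uM] : exists M, forall k, `|series u k| <= M.
  have [M [_ /(_ (M + 1))]] := cvg_seq_bounded cu.
  by rewrite ltrDl ltr01 => /(_ isT) uM; exists (M + 1) => k; exact: uM.
have sa0 k : 0 <= series a k by exact: sumr_ge0.
pose v k := d k + series a k - series u k.
have vS : nonincreasing_seq v.
  apply/nonincreasing_seqP => k; rewrite /v ![series _ k.+1]seriesSr.
  by have := du k; lra.
have cv : cvgn v.
  apply: nonincreasing_is_cvgn => //; exists (- M) => _ [k _ <-]; rewrite /v.
  by have := d0 k; have := sa0 k; have := uM k; rewrite ler_norml; lra.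
have ca : cvgn (series a).
  apply: nondecreasing_is_cvgn; first by apply: nondecreasing_series => i _ _.
  exists (v 0%N + M) => _ [k _ <-].
  have := vS 0%N k (leq0n k); have := uM k; rewrite ler_norml [v k]/v.
  by have := d0 k; lra.
split=> //; rewrite (_ : d = v + series u - series a); last first.
  by apply/funext => k; rewrite !fctE /v; ring.
by apply: is_cvgB => //; exact: is_cvgD.
Qed.

End RealSeries.

(** * Minimizers of a Lipschitz function on a closed set *)

Section Minimizers.
Context {R : realType} {n : nat} (K : set 'rV[R]_n) (G : 'rV[R]_n -> R) (L : R).
Hypothesis K_closed : closed K.
Hypothesis G_lip : forall x y, K x -> K y -> `|G x - G y| <= L * enorm (x - y).
Implicit Types x y : 'rV[R]_n.

Definition minimizer : set 'rV[R]_n :=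
  [set y | K y /\ forall x, K x -> G y <= G x].

Lemma minimizer_near y : K y -> 0 <= L ->
  (forall e, 0 < e -> exists z y', [/\ K z, minimizer y',
     `|y - z| <= e & G z <= G y' + e]) -> minimizer y.
Proof.
move=> Ky L0 H; split=> // x Kx; apply/ler_addgt0Pr => e e0.
(* Chosen so that the Lipschitz error [L * Num.sqrt n%:R * (e / C)] and the gap [e / C] add up to
   [e]. *)
pose C := L * Num.sqrt n%:R + 1.
have C0 : 0 < C by rewrite ltr_wpDl // mulr_ge0 ?sqrtr_ge0.
have [z [y' [Kz [_ y'min] yz Gz]]] := H (e / C) (divr_gt0 e0 C0).
have := G_lip _ _ Ky Kz; rewrite ler_norml => /andP[_ Gyz].
have yz' : L * enorm (y - z) <= L * Num.sqrt n%:R * (e / C).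
  rewrite -mulrA ler_wpM2l // (le_trans (enorm_le_norm _)) //.
  by rewrite ler_wpM2l ?sqrtr_ge0.
have eC : L * Num.sqrt n%:R * (e / C) + e / C = e.
  by rewrite -[X in _ + X]mul1r -mulrDl mulrCA divff ?mulr1 // gt_eqF.
by have := y'min x Kx; lra.
Qed.

(** Transfers convergence to a path from trajectories uniformly close to it: the path is Cauchy, and
    its limit is a limit of minimizers. *)
Lemma uniform_limit_minimizer (x : nat -> 'rV[R]_n) : 0 <= L ->
  (forall k, K (x k)) ->
  (forall e, 0 < e -> exists (z : nat -> 'rV[R]_n) y, [/\ minimizer y,
     z k @[k --> \oo] --> y & forall k, `|x k - z k| <= e]) ->
  exists2 y, minimizer y & x k @[k --> \oo] --> y.
Proof.
move=> L0 Kx H.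
have near_min e : 0 < e ->
    exists2 y, minimizer y & \forall k \near \oo, `|y - x k| < e.
  move=> e0; have e20 : 0 < e / 2 by rewrite divr_gt0.
  have [z [y [ymin zy xz]]] := H _ e20; exists y => //.
  move/cvgrPdist_lt/(_ _ e20) : zy; apply: filterS => k yz.
  have := xz k; rewrite distrC => xz'.
  by rewrite (le_lt_trans (ler_distD (z k) _ _)) // (splitr e) ltr_leD.
have : cvg (x k @[k --> \oo]).
  apply/cauchy_cvgP/cauchy_exP => e /near_min[y _ xy].
  by exists y; apply: filterS xy => k; rewrite -ball_normE.
move/cvg_ex => [/= l xl]; exists l => //.
have Kl : K l by apply: (closed_cvg K K_closed _ l xl); apply: nearW.
apply: minimizer_near => // e e0.
have e20 : 0 < e / 2 by rewrite divr_gt0.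
have [y ymin xy] := near_min _ e20.
move/cvgrPdist_lt/(_ _ e20) : xl => xl.
have [k [lk yk]] := filter_ex (filterI xl xy).
exists y, y; split=> //; [by case: ymin| |by rewrite lerDl ltW].
rewrite (le_trans (ler_distD (x k) _ _)) // (splitr e) lerD ?(ltW lk) //.
by rewrite distrC ltW.
Qed.

(** The values are nearly minimal only along a subsequence, which is therefore extracted before
    compactness of a box gives a cluster point. *)
Lemma bounded_minimizing_cluster (x : nat -> 'rV[R]_n) (C : R) ymin : 0 <= L ->
  minimizer ymin ->
  (forall k, K (x k)) -> (forall k, `|x k| <= C) ->
  (forall e m, 0 < e -> exists2 k, (m <= k)%N & G (x k) < G ymin + e) ->
  exists2 y, minimizer y &
    forall e m, 0 < e -> exists2 k, (m <= k)%N & `|y - x k| < e.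
Proof.
move=> L0 y0min Kx xC H.
have /choice[s sP] : forall m, exists k, (m <= k)%N /\ G (x k) < G ymin + m.+1%:R^-1.
  by move=> m; have [|k mk xk] := H m.+1%:R^-1 m; [rewrite invr_gt0|exists k].
pose A := [set v : 'rV[R]_n | forall i, `[- C, C]%classic (v ord0 i)].
have cA : compact A.
  apply: (@rV_compact R n (fun=> `[- C, C]%classic)) => i.
  exact: segment_compact.
have FA : \forall m \near \oo, A (x (s m)).
  apply: nearW => m i /=; rewrite in_itv /= -ler_norml.
  apply: le_trans (xC (s m)); rewrite [leRHS]mx_normrE.
  exact: (le_bigmax _ (fun ij => `|x (s m) ij.1 ij.2|) (ord0, i)).
have [y [_ ycl]] := cA (x (s m) @[m --> \oo]) _ FA.
have near_y e m : 0 < e -> exists2 k, (m <= k)%N &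
    `|y - x k| < e /\ G (x k) < G ymin + e.
  move=> e0.
  have [p _ pe] := near_infty_natSinv_lt (PosNum e0).
  have : (x (s k) @[k --> \oo]) (x @` [set k | (m <= k)%N /\ G (x k) < G ymin + e]).
    exists (maxn p m) => // j /=; rewrite geq_max => /andP[pj mj].
    exists (s j) => //; have [js sj] := sP j; split; first exact: leq_trans js.
    by apply: lt_trans sj _; rewrite ltrD2l; exact: pe.
  move=> /ycl /(_ (nbhsx_ballx y e e0))[_ [[k [mk xk] <-]]].
  by rewrite -ball_normE => yk; exists k.
have Ky : K y.
  apply: K_closed => B /nbhs_ballP[e /= e0 yB].
  have [k _ [yk _]] := near_y e 0%N e0.
  by exists (x k); split=> //; apply: yB; rewrite -ball_normE.
exists y; last by move=> e m /(near_y e m)[k mk [yk _]]; exists k.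
apply: minimizer_near => // e /(near_y e 0%N)[k _ [yk xk]].
by exists (x k), ymin; split=> //; exact: ltW.
Qed.

End Minimizers.

Arguments uniform_limit_minimizer {R n K G L} K_closed G_lip {x}.
Arguments bounded_minimizing_cluster {R n K G L} K_closed G_lip {x C ymin}.

(** * Estimates for a single proximal step *)

Section ProxSteps.
Context {R : realType} {n : nat} (K : set 'rV[R]_n) (alpha : R).
Hypothesis alpha0 : 0 < alpha.
Implicit Types (phi : 'rV[R]_n -> R) (x y z w : 'rV[R]_n).

(** Retains from the proximal minimization only the variational inequality, from which both
    estimates below follow. *)
Definition prox_step phi (beta : R) z z' : Prop :=
  K z' /\ forall x, K x ->
    phi z' - phi x <= alpha / beta * edot (z' - z) (x - z').

(** Testing each inequality at the result of the other step and adding cancels the values of [phi];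
    Cauchy-Schwarz concludes. *)
Lemma prox_step_nonexpansive phi beta z z' w w' : 0 < beta ->
  prox_step phi beta z z' -> prox_step phi beta w w' ->
  enorm (z' - w') <= enorm (z - w).
Proof.
move=> b0 [Kz' Hz] [Kw' Hw]; have ab : 0 < alpha / beta by rewrite divr_gt0.
have := lerD (Hz _ Kw') (Hw _ Kz').
rewrite -mulrDr addrC subrKA subrr pmulr_rge0 //.
have -> : edot (z' - z) (w' - z') + edot (w' - w) (z' - w') =
    edot (z - w) (z' - w') - enorm (z' - w') ^+ 2.
  by rewrite enorm_sqr !(edotBl, edotBr) (edotC w' z'); ring.
rewrite subr_ge0 => /le_trans /(_ (edot_le _ _)); rewrite expr2.
have [->|t0] := eqVneq (enorm (z' - w')) 0; first by rewrite enorm_ge0.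
by rewrite ler_pM2r // lt_def t0 enorm_ge0.
Qed.

(** The Lipschitz bound replaces [phi z'] by [phi z]; the resulting linear term in [enorm (z' - z)]
    is absorbed by its square on completing the square. *)
Lemma prox_step_descent phi beta L z z' y : 0 < beta ->
  `|phi z - phi z'| <= L * enorm (z - z') ->
  prox_step phi beta z z' -> K y ->
  enorm (z' - y) ^+ 2 <= enorm (z - y) ^+ 2
    - 2 * beta / alpha * (phi z - phi y) + (L / alpha) ^+ 2 * beta ^+ 2.
Proof.
move=> b0 lip [_ Hz] Ky; set c := 2 * beta / alpha.
have c0 : 0 < c by rewrite divr_gt0 ?mulr_gt0.
have H : c * (phi z' - phi y) <=
    enorm (z - y) ^+ 2 - enorm (z' - z) ^+ 2 - enorm (z' - y) ^+ 2.
  rewrite -enorm_sqr_split; apply: (le_trans (ler_wpM2l (ltW c0) (Hz _ Ky))).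
  rewrite le_eqVlt; apply/orP; left; apply/eqP; rewrite /c; field.
  by rewrite !gt_eqF.
have H' : c * (phi z - phi z') <= c * (L * enorm (z' - z)).
  by rewrite ler_pM2l // enormBC (le_trans (ler_norm _)).
have -> : (L / alpha) ^+ 2 * beta ^+ 2 = (c * L / 2) ^+ 2.
  by rewrite /c; field; rewrite gt_eqF.
have := sqr_ge0 (enorm (z' - z) - c * L / 2); lra.
Qed.

End ProxSteps.

Arguments prox_step_nonexpansive {R n K alpha} alpha0 {phi beta z z' w w'}.
Arguments prox_step_descent {R n K alpha} alpha0 {phi beta L z z' y}.

(** * Convergence of proximal paths, on one outcome and almost surely *)

Section ProxPaths.
Context {R : realType} {n N : nat} (K : set 'rV[R]_n) (alpha L : R).
Local Notation I := 'I_N.+1.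
Context (phi : I -> 'rV[R]_n -> R) (b : nat -> R).
Hypothesis K_closed : closed K.
Hypothesis alpha0 : 0 < alpha.
Hypothesis L0 : 0 <= L.
Hypothesis phi_lip : forall i x y, K x -> K y ->
  `|phi i x - phi i y| <= L * enorm (x - y).
Hypothesis b0 : forall k, 0 < b k.
Hypothesis b_dvg : ~ cvgn (series b).
Hypothesis b2_cvg : cvgn (series (fun k => b k ^+ 2)).

Definition total x : R := \sum_(i < N.+1) phi i x.

Lemma total_lip x y : K x -> K y ->
  `|total x - total y| <= N.+1%:R * L * enorm (x - y).
Proof.
move=> Kx Ky; rewrite /total -sumrB (le_trans (ler_norm_sum _ _ _)) //.
apply: (@le_trans _ _ (\sum_(i < N.+1) L * enorm (x - y))).
  by apply: ler_sum => i _; exact: phi_lip.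
by rewrite sumr_const card_ord -[(L * _) *+ _]mulr_natl mulrA.
Qed.

(** Taking differences with the values at [y] keeps the noise within a multiple of [enorm (z - y)],
    which the descent estimate controls. *)
Definition noise y z (i : I) : R :=
  N.+1%:R^-1 * (total z - total y) - (phi i z - phi i y).

Lemma sum_noise y z : \sum_(i < N.+1) noise y z i = 0.
Proof.
rewrite /noise sumrB sumr_const card_ord -[(_ * _) *+ _]mulr_natl mulrA divff ?pnatr_eq0 //.
by rewrite mul1r sumrB subrr.
Qed.

Lemma noise_le y z i : K y -> K z -> `|noise y z i| <= 2 * L * enorm (z - y).
Proof.
move=> Ky Kz; rewrite (le_trans (ler_normB _ _)) // normrM.
rewrite (ger0_norm (_ : 0 <= N.+1%:R^-1)) ?invr_ge0 //.
have : N.+1%:R^-1 * `|total z - total y| <= L * enorm (z - y).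
  by rewrite ler_pdivrMl ?ltr0n // mulrA total_lip.
by move=> h; rewrite -mulrA mulr_natl mulr2n; apply: lerD => //; exact: phi_lip.
Qed.

(* The part of the noise depending on the minimizer is a combination of finitely
   many scalar series, so that one null set serves for all minimizers. *)
Lemma noise_split y0 y k (j : I) :
  b k * noise y0 y j = - \sum_(i < N.+1) (phi i y0 - phi i y) *
    (b k * (N.+1%:R^-1 - (j == i)%:R)).
Proof.
rewrite (eq_bigr (fun i => b k * N.+1%:R^-1 * (phi i y0 - phi i y) -
  b k * ((phi i y0 - phi i y) * (j == i)%:R))); last by move=> i _; ring.
have E : \sum_(i < N.+1) (phi i y0 - phi i y) * (j == i)%:R =
    phi j y0 - phi j y.
  rewrite (bigD1 j) //= eqxx mulr1 big1 ?addr0 // => i /negbTE.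
  by rewrite eq_sym => ->; rewrite mulr0.
rewrite sumrB -!mulr_sumr E sumrB -/(total y0) -/(total y).
by rewrite /noise; ring.
Qed.

(** The deterministic part. The last series concerns [y0] only; the scalar series extend its
    convergence to every minimizer. *)
Lemma prox_path_cvg (u : nat -> I) (x : nat -> 'rV[R]_n) y0 :
  minimizer K total y0 -> (forall k, K (x k)) ->
  (forall k, prox_step K alpha (phi (u k)) (b k) (x k) (x k.+1)) ->
  (forall i, cvgn (series (fun k => b k * (N.+1%:R^-1 - (u k == i)%:R)))) ->
  cvgn (series (fun k => b k * noise y0 (x k) (u k))) ->
  exists2 y, minimizer K total y & x k @[k --> \oo] --> y.
Proof.
move=> y0min Kx step cB cA.
have gap0 y k : minimizer K total y ->
    0 <= 2 * b k / alpha * (N.+1%:R^-1 * (total (x k) - total y)).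
  move=> [_ yle]; apply: mulr_ge0; first by rewrite divr_ge0 ?mulr_ge0 // ltW.
  by rewrite mulr_ge0 ?invr_ge0 // subr_ge0 yle.
have key y : minimizer K total y ->
    cvgn (fun k => enorm (x k - y) ^+ 2) /\
    cvgn (series (fun k => 2 * b k / alpha *
      (N.+1%:R^-1 * (total (x k) - total y)))).
  (* [e] is the correction that turns the noise relative to [y0] into the noise relative to [y]. *)
  move=> ymin; have [Ky _] := ymin; pose e k := \sum_(i < N.+1) (phi i y0 - phi i y) *
    (b k * (N.+1%:R^-1 - (u k == i)%:R)).
  pose v := (2 / alpha) *: ((fun k => b k * noise y0 (x k) (u k)) + e) +
    (L / alpha) ^+ 2 *: (fun k => b k ^+ 2).
  apply: (@almost_decreasing_cvg _ _ _ v).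
  - by move=> k; exact: sqr_ge0.
  - by move=> k; exact: gap0.
  - move=> k; have := prox_step_descent alpha0 (b0 k)
      (phi_lip _ _ _ (Kx k) (Kx k.+1)) (step k) Ky.
    move=> /le_trans; apply.
    have ek : e k = - (b k * noise y0 y (u k)) by rewrite noise_split opprK.
    rewrite le_eqVlt; apply/orP; left; apply/eqP.
    rewrite /v !fctE ek /noise /GRing.scale /=; field.
    by rewrite gt_eqF //= pnatr_eq0.
  - apply: is_cvg_seriesD; apply: is_cvg_seriesZ => //.
    by apply: is_cvg_seriesD => //; exact: is_cvg_series_sum.
have [C xC] : exists C, forall k, `|x k| <= C.
  have [cd _] := key _ y0min.
  have [M [_ /(_ (M + 1))]] := cvg_seq_bounded cd.
  rewrite ltrDl ltr01 => /(_ isT) dM; exists (M + 2 + `|y0|) => k.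
  have := dM k Logic.I; rewrite /= ger0_norm ?sqr_ge0 // => dk.
  have := norm_le_enorm (x k - y0); have := sqr_ge0 (enorm (x k - y0) - 1).
  have := ler_normD (x k - y0) y0; rewrite subrK; have := enorm_ge0 (x k - y0).
  by nra.
(* Were the gap at least [e] from [m] on, the summable weighted gaps would dominate a multiple of
   [b]. *)
have inf e m : 0 < e ->
    exists2 k, (m <= k)%N & total (x k) < total y0 + e.
  move=> e0; apply: contrapT => H; apply: b_dvg.
  have [_ ca] := key _ y0min.
  apply: (@is_cvg_series_dominated _ _ _ (alpha * N.+1%:R / (2 * e)) m ca).
  - by move=> k; exact: gap0.
  - by move=> k; exact: ltW.
  - by rewrite divr_ge0 ?mulr_ge0 // ltW.
  - move=> k mk.
    have xk : e <= total (x k) - total y0.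
      by rewrite lerBrDl leNgt; apply/negP => xk; apply: H; exists k.
    have -> : alpha * N.+1%:R / (2 * e) * (2 * b k / alpha *
        (N.+1%:R^-1 * (total (x k) - total y0))) =
        b k * ((total (x k) - total y0) / e).
      by field; rewrite !gt_eqF //= pnatr_eq0.
    by rewrite ler_pMr // ler_pdivlMr // mul1r.
have NL0 : 0 <= N.+1%:R * L by rewrite mulr_ge0.
have [y ymin ycl] :=
  bounded_minimizing_cluster K_closed total_lip NL0 y0min Kx xC inf.
exists y => //; have [cd _] := key _ ymin.
have dl := cd; set l := lim _ in dl.
(* The squared distances to [y] converge and are arbitrarily small infinitely often. *)
have l0 : l <= 0.
  apply/ler_addgt0Pr => e e0; rewrite add0r.
  have e20 : 0 < e / 2 by rewrite divr_gt0.
  (* The squared Euclidean norm is at most [n] times the squared sup norm; the [+ 1] covers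
     [n = 0]. *)
  have D0 : 0 < n%:R + 1 :> R by rewrite ltr_wpDl.
  move/cvgrPdist_lt/(_ _ e20) : dl => [m _ dl].
  have s0 : 0 < Num.sqrt (e / 2 / (n%:R + 1)) by rewrite sqrtr_gt0 divr_gt0.
  have [k mk yk] := ycl _ m s0.
  have := dl k mk; rewrite ltr_norml => /andP[_].
  suff : enorm (x k - y) ^+ 2 <= e / 2 by lra.
  have := enorm_le_norm (x k - y).
  rewrite -ler_sqr ?nnegrE ?enorm_ge0 ?mulr_ge0 ?sqrtr_ge0 //.
  move=> /le_trans; apply.
  move: yk; rewrite distrC -ltr_sqr ?nnegrE ?sqrtr_ge0 // sqr_sqrtr; last first.
    by rewrite ltW // divr_gt0.
  rewrite ltr_pdivlMr // exprMn sqr_sqrtr // => yk.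
  by have := sqr_ge0 `|x k - y|; nra.
apply/cvgrPdist_lt => e e0.
have ee0 : 0 < e ^+ 2 by rewrite exprn_gt0.
move/cvgrPdist_lt/(_ _ ee0) : dl; apply: filterS => k.
rewrite ltr_norml => /andP[+ _] => dk.
rewrite distrC (le_lt_trans (norm_le_enorm _)) //.
by rewrite -ltr_sqr ?nnegrE ?enorm_ge0 ?ltW //; lra.
Qed.

(** As a function of the history, the iterate yields increments [g h i] of the form required by
    [martingale_cvg]. *)
Fixpoint traj (p : nat -> I -> 'rV[R]_n -> 'rV[R]_n) (z : 'rV[R]_n) (h : seq I) :=
  if h is i :: h' then p (size h') i (traj p z h') else z.

Context {d : measure_display} {T : measurableType d} (P : probability T R).
Variable r : nat -> T -> I.
Hypothesis r_measurable : forall k i, measurable (r k @^-1` [set i]).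
Hypothesis cylinder_le :
  forall h, (P (cylinder r h) <= (N.+1%:R ^- size h)%:E)%E.
Variable p : nat -> I -> 'rV[R]_n -> 'rV[R]_n.
Hypothesis p_step : forall k i z, K z ->
  prox_step K alpha (phi i) (b k) z (p k i z).

Lemma traj_mem z h : K z -> K (traj p z h).
Proof. by move=> Kz; elim: h => //= i h IH; have [] := p_step (size h) i _ IH. Qed.

(** The increments are at most [b k] in absolute value, so the constant variance bound [1] with
    [c = 0] applies. *)
Lemma index_noise_cvg : {ae P, forall w i,
  cvgn (series (fun k => b k * (N.+1%:R^-1 - (r k w == i)%:R)))}.
Proof.
have H i : {ae P, forall w,
    cvgn (series (fun k => b k * (N.+1%:R^-1 - (r k w == i)%:R)))}.
  pose g (h : seq I) j := b (size h) * (N.+1%:R^-1 - (j == i)%:R).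
  have gE w : (fun k => g (history (r^~ w) k) (r k w)) =
      (fun k => b k * (N.+1%:R^-1 - (r k w == i)%:R)).
    by apply/funext => k; rewrite /g size_history.
  have : {ae P, forall w, cvgn (series (fun k => g (history (r^~ w) k) (r k w)))};
    last by apply: filterS => w; rewrite gE.
  apply: (martingale_cvg P r r_measurable cylinder_le b g (fun=> 1) 0 b2_cvg) => //.
  - by move=> h; rewrite sumr_const card_ord mul0r addr0 mulr1.
  - move=> h j; rewrite /g exprMn mulr1 ler_piMr ?sqr_ge0 //.
    rewrite -(real_normK (num_real (_ - _))) expr_le1 // ler_norml.
    have q0 : 0 <= N.+1%:R^-1 :> R by rewrite invr_ge0.
    have q1 : N.+1%:R^-1 <= 1 :> R by rewrite invf_le1 ?ler1n ?ltr0n.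
    by move: q0 q1; move: (N.+1%:R^-1) => q q0 q1; case: (j == i) => /=; lra.
  - move=> h; rewrite /g -mulr_sumr sumrB sumr_const card_ord -[_^-1 *+ _]mulr_natl divff ?pnatr_eq0 //.
    rewrite (bigD1 i) //= eqxx big1 ?addr0 ?subrr ?mulr0 //.
    by move=> j /negbTE ->.
have := ae_foralln (fun m => H (inord m)).
by apply: filterS => w Hw i; rewrite -(inord_val i).
Qed.

Lemma traj_cvg y0 z : minimizer K total y0 -> K z -> {ae P, forall w,
  exists2 y, minimizer K total y &
    traj p z (history (r^~ w) k) @[k --> \oo] --> y}.
Proof.
move=> y0min Kz; have [Ky0 y0le] := y0min.
(* Summed over [i], the linear terms of the descent inequality give a multiple of
   [total phi X - total phi y0], which is nonnegative; hence [D] grows in mean by at most a multiple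
   of [b k ^+ 2]. *)
pose D h := (2 * L) ^+ 2 * enorm (traj p z h - y0) ^+ 2.
have : {ae P, forall w, cvgn (series (fun k => b k *
    noise y0 (traj p z (history (r^~ w) k)) (r k w)))}.
  pose g (h : seq I) j := b (size h) * noise y0 (traj p z h) j.
  have gE w : (fun k => g (history (r^~ w) k) (r k w)) =
      (fun k => b k * noise y0 (traj p z (history (r^~ w) k)) (r k w)).
    by apply/funext => k; rewrite /g size_history.
  have : {ae P, forall w, cvgn (series (fun k => g (history (r^~ w) k) (r k w)))};
    last by apply: filterS => w; rewrite gE.
  apply: (martingale_cvg P r r_measurable cylinder_le b g D
    ((2 * L) ^+ 2 * (L / alpha) ^+ 2) b2_cvg).
  - by rewrite mulr_ge0 ?sqr_ge0.
  - by move=> h; rewrite mulr_ge0 ?sqr_ge0.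
  - move=> h; set X := traj p z h; set k := size h.
    have KX : K X by exact: traj_mem.
    have step i : enorm (p k i X - y0) ^+ 2 <= enorm (X - y0) ^+ 2
        + (L / alpha) ^+ 2 * b k ^+ 2 - 2 * b k / alpha * (phi i X - phi i y0).
      have pX := p_step k i _ KX.
      have := prox_step_descent alpha0 (b0 k) (phi_lip i _ _ KX (proj1 pX)) pX Ky0.
      by lra.
    rewrite /D /= -/X -/k -mulr_sumr -mulrA -mulrDr mulrCA.
    apply: ler_wpM2l; first exact: sqr_ge0.
    apply: (@le_trans _ _ (\sum_(i < N.+1) (enorm (X - y0) ^+ 2
        + (L / alpha) ^+ 2 * b k ^+ 2 - 2 * b k / alpha * (phi i X - phi i y0)))).
      by apply: ler_sum => i _; exact: step.
    rewrite sumrB sumr_const card_ord -[(_ + _) *+ _]mulr_natl lerBlDr lerDl -mulr_sumr.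
    apply: mulr_ge0; first by rewrite divr_ge0 ?mulr_ge0 // ltW.
    by rewrite sumrB subr_ge0; exact: y0le.
  - move=> h i; rewrite /g /D -[X in _ <= _ * X]exprMn [leLHS]exprMn ler_wpM2l ?sqr_ge0 //.
    rewrite -(real_normK (num_real (noise _ _ _))) ler_sqr ?nnegrE ?mulr_ge0 ?enorm_ge0 //.
    by apply: noise_le => //; exact: traj_mem.
  - by move=> h; rewrite /g -mulr_sumr sum_noise mulr0.
apply: filterS2 index_noise_cvg => w cB cA.
apply: (@prox_path_cvg (r^~ w) _ y0) => // k; first exact: traj_mem.
by rewrite /= size_history; apply: p_step; exact: traj_mem.
Qed.

End ProxPaths.

(** * A dense sequence in [K], and reformulations of series conditions *)

Lemma rational_approx {R : realType} {n : nat} (x : 'rV[R]_n) (e : R) : 0 < e ->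
  exists q : 'rV[rat]_n, `|x - map_mx ratr q| < e.
Proof.
move=> e0.
have /choice[s sP] : forall i, exists s : rat, `|x 0 i - ratr s| < e.
  move=> i; have [|s] := @rat_in_itvoo _ (x 0 i) (x 0 i + e); first by rewrite ltrDl.
  rewrite in_itv /= => /andP[xs sx]; exists s.
  by rewrite distrC ger0_norm ?subr_ge0 ?ltW // ltrBlDl.
exists (\row_i s i); rewrite [`|_|]mx_normrE.
apply/bigmax_ltP; split => // -[i j] _ /=.
by rewrite !mxE ord1.
Qed.

(** As [K] may contain no rational point, each rational center and radius selects a nearby point of
    [K] if there is one, and [x0] otherwise. *)
Lemma dense_sequence {R : realType} {n : nat} (K : set 'rV[R]_n) : K !=set0 ->
  exists D : nat -> 'rV[R]_n, (forall j, K (D j)) /\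
    forall x e, K x -> 0 < e -> exists j, `|x - D j| < e.
Proof.
move=> [x0 Kx0].
pose Q j := [set y | K y /\ exists2 qm : 'rV[rat]_n * nat,
  unpickle j = Some qm & `|y - map_mx ratr qm.1| < qm.2.+1%:R^-1].
exists (fun j => xget x0 (Q j)); split=> [j|x e Kx e0].
  by case: xgetP => [y _ []|].
have e20 : 0 < e / 2 by rewrite divr_gt0.
have [m _ /(_ m (leqnn m)) /= me] := near_infty_natSinv_lt (PosNum e20).
have [q xq] : exists q : 'rV[rat]_n, `|x - map_mx ratr q| < m.+1%:R^-1.
  by apply: rational_approx; rewrite invr_gt0.
exists (pickle (q, m)).
have [Ky [qm]] : Q (pickle (q, m)) (xget x0 (Q (pickle (q, m)))).
  by apply: xgetPex; exists x; split=> //; exists (q, m); rewrite ?pickleK.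
rewrite pickleK => -[<-] /= yq.
rewrite (le_lt_trans (ler_distD (map_mx ratr q) _ _)) // (splitr e).
by rewrite ltrD ?(lt_trans xq) // distrC (lt_trans yq).
Qed.

Lemma is_cvg_series_shiftS {R : realType} (u : nat -> R) :
  cvgn (series (fun k => u k.+1)) <-> cvgn (series u).
Proof.
rewrite -(is_cvg_series_restrict 1 u).
have -> : series (fun k => u k.+1) = (fun k => \sum_(1 <= i < k.+1) u i).
  by apply/funext => k; rewrite big_add1.
split=> /cvg_ex[/= l ul]; apply/cvg_ex; exists l.
  by rewrite -(cvg_shiftS (fun k => \sum_(1 <= i < k) u i)).
by rewrite (cvg_shiftS (fun k => \sum_(1 <= i < k) u i)).
Qed.

Lemma cvg_series_nneseries {R : realType} (u : nat -> R) : (forall k, 0 <= u k) ->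
  cvgn (series u) <-> (\sum_(0 <= k <oo) (u k)%:E < +oo)%E.
Proof.
move=> u0.
have uE0 k : (0 <= k)%N -> xpredT k -> (0 <= (u k)%:E)%E by rewrite lee_fin.
have ndu : nondecreasing_seq (series u) by apply: nondecreasing_series.
split=> [cu|sumu].
  apply: (@le_lt_trans _ _ (limn (series u))%:E); last exact: ltry.
  apply: lime_le; first exact: is_cvg_nneseries.
  by apply: nearW => k; rewrite sumEFin lee_fin; exact: nondecreasing_cvgn_le.
apply: nondecreasing_is_cvgn => //.
exists (fine (\sum_(0 <= k <oo) (u k)%:E)%E) => _ [k _ <-].
rewrite -lee_fin fineK; last first.
  by rewrite ge0_fin_numE //; exact: nneseries_ge0.
by rewrite /series /= -sumEFin; exact: nneseries_lim_ge.
Qed.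

(** * Probabilities of histories of the sampled indices *)

Section SampledIndices.
Context {R : realType} {N : nat} {d : measure_display} {T : measurableType d}.
Context (P : probability T R) (r : nat -> {RV P >-> 'I_N.+1}).
Hypothesis r_unif : forall k, uniformly_distributed (r k).
Hypothesis r_indep : mutually_independent r.

Lemma measurable_index k i : measurable (r k @^-1` [set i]).
Proof.
have := @measurable_funP _ _ _ _ setT (r k) measurableT [set i] Logic.I.
by rewrite setTI.
Qed.

Lemma index_prob k i : P (r k @^-1` [set i]) = (N.+1%:R^-1)%:E.
Proof.
have := r_unif k [set i]%SET; rewrite /unif cards1 mul1r => <-.
by congr (P (_ @^-1` _)); apply/seteqP; split => j /=; rewrite inE => /eqP.
Qed.

Lemma cylinder_shift_le h :
  (P (cylinder (fun k => r k.+1) h) <= (N.+1%:R ^- size h)%:E)%E.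
Proof.
(* Times run from [1] to [size h] and the latest index comes first, so the index drawn at time [k]
   is entry [size h - k]. *)
pose A h k : set 'I_N.+1 := [set nth ord0 h (size h - k)].
have sub : cylinder (fun k => r k.+1) h `<=`
    \bigcap_(k in [set` iota 1 (size h)]) r k @^-1` A h k.
  elim: h => [//|i h IH] w [/= wi wh] k /=.
  rewrite -/(iota 1 (size h).+1) mem_iota add1n => /andP[k1].
  rewrite ltnS leq_eqVlt => /orP[/eqP ->|kh].
    by rewrite /A /= subnn.
  rewrite /A /= subSn //=; apply: IH => //=.
  by rewrite mem_iota k1.
apply: (@le_trans _ _
    (P (\bigcap_(k in [set` iota 1 (size h)]) r k @^-1` A h k))).
  apply: le_measure => //; rewrite inE.
    by apply: measurable_cylinder => k i; exact: measurable_index.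
  by apply: bigcap_measurableType => k _; exact: measurable_index.
rewrite r_indep ?iota_uniq // le_eqVlt; apply/orP; left; apply/eqP.
rewrite -[in RHS](size_iota 1 (size h)).
elim: (iota 1 (size h)) => [|k s IH]; first by rewrite big_nil expr0 invr1.
by rewrite big_cons IH index_prob -EFinM exprS invfM.
Qed.

End SampledIndices.

Theorem theorem3p3 (R : realType) (n N : nat) (K : set 'rV[R]_n)
    (f : 'I_N.+1 -> 'rV[R]_n -> \bar R)
    (P : probability (sequence_space N) R)
    (r : nat -> {RV P >-> 'I_N.+1})
    (x0 : 'rV[R]_n) (beta : nat -> R) (alpha : R)
    (x : nat -> sequence_space N -> 'rV[R]_n) :
  K !=set0 -> closed K ->
  (forall i, proper_on K (f i)) ->
  (forall i, lsc_on K (f i)) ->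
  is_uniform_product P ->
  (forall k, uniformly_distributed (r k)) ->
  mutually_independent r ->
  (forall k, 0 < beta k) ->
  (\sum_(0 <= k <oo) (beta k)%:E = +oo)%E ->
  (\sum_(0 <= k <oo) ((beta k) ^+ 2)%:E < +oo)%E ->
  (forall w, x 0%N w = x0) ->
  (forall k w, Prox K (beta k) (f (r k w)) (x k w) (x k.+1 w)) ->
  argmin K (fun y => \sum_(i < N.+1) f i y)%E !=set0 ->
  (forall i, lipschitz_continuous_on K (f i)) ->
  (forall i k, prox_convex_with K (beta k) alpha (f i)) ->
  {ae P, forall w, exists xbar : 'rV[R]_n,
    argmin K (fun y => \sum_(i < N.+1) f i y)%E xbar /\
    x k w @[k --> \oo] --> xbar}.
Proof.
move=> K0 K_closed _ _ _ r_unif r_indep beta0 sum_beta sum_beta2 _ x_step.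
move=> argmin0 f_lip f_prox.
have alpha0 : 0 < alpha by have [] := f_prox ord0 0%N.
have [Li LiP] := choice f_lip.
pose phi i y := fine (f i y); pose L := \sum_(i < N.+1) `|Li i|.
have L0 : 0 <= L by exact: sumr_ge0.
have fE i y : K y -> f i y = (phi i y)%:E.
  by move=> Ky; have := LiP i y y Ky Ky; rewrite /phi; case: (f i y).
have phi_lip i y z : K y -> K z -> `|phi i y - phi i z| <= L * enorm (y - z).
  move=> Ky Kz; have := LiP i y z Ky Kz; rewrite !fE // -EFinB lee_fin.
  move=> /le_trans; apply; rewrite ler_wpM2r ?enorm_ge0 //.
  by rewrite (le_trans (ler_norm _)) // /L (bigD1 i) //= lerDl sumr_ge0.
have sumE y : K y -> (\sum_(i < N.+1) f i y)%E = (total phi y)%:E.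
  by move=> Ky; rewrite -sumEFin; apply: eq_bigr => i _; exact: fE.
have argminE y : argmin K (fun y => \sum_(i < N.+1) f i y)%E y <->
    minimizer K (total phi) y.
  by split=> -[Ky yle]; split=> // z Kz; have := yle z Kz;
    rewrite !sumE // lee_fin.
have [y0 /argminE y0min] := argmin0.
have f_step i k z z' : K z -> Prox K (beta k) (f i) z z' ->
    prox_step K alpha (phi i) (beta k) z z'.
  move=> Kz zz'; have [Kz' _] := zz'; split=> // y Ky.
  have [_ _ /(_ z z' Kz zz' y Ky)] := f_prox i k.
  by rewrite !fE // -EFinB lee_fin.
(* As x0 need not lie in K, the trajectories are started at the first iterate,
   which may depend on w in a non-measurable way. *)
pose b k := beta k.+1; pose r1 k := r k.+1; pose x1 k w := x k.+1 w.
have b0 k : 0 < b k by exact: beta0.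
have b_dvg : ~ cvgn (series b).
  move=> /is_cvg_series_shiftS; rewrite cvg_series_nneseries ?sum_beta //.
  by move=> k; exact: ltW.
have b2_cvg : cvgn (series (fun k => b k ^+ 2)).
  apply/(is_cvg_series_shiftS (fun k => beta k ^+ 2)).
  by apply/cvg_series_nneseries => // k; exact: sqr_ge0.
(* A selection of proximal points fixed in advance makes the trajectories functions of the
   history. *)
pose p k i z := xget z (prox_step K alpha (phi i) (b k) z).
have p_step k i z : K z -> prox_step K alpha (phi i) (b k) z (p k i z).
  move=> Kz; apply: xgetPex; have [_ /(_ z Kz)[z' zz'] _] := f_prox i k.+1.
  by exists z'; exact: f_step.
have [D [KD D_dense]] := dense_sequence K K0.
(* One null set serves all starting points [D j], wherever [x1 0 w] lies in [K]. *)
have := ae_foralln (fun j => traj_cvg K alpha L phi b K_closed alpha0 L0 phi_lip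
  b0 b_dvg b2_cvg P r1 (fun k i => measurable_index P r k.+1 i)
  (cylinder_shift_le P r r_unif r_indep) p p_step y0 (D j) y0min (KD j)).
apply: filterS => w Dw.
have Kx1 k : K (x1 k w) by have [] := x_step k w.
have x1_step k : prox_step K alpha (phi (r1 k w)) (b k) (x1 k w) (x1 k.+1 w).
  by apply: f_step => //; exact: x_step.
have [e e0|y ymin xy] := uniform_limit_minimizer K_closed
    (total_lip K L phi phi_lip) (mulr_ge0 (ler0n _ _) L0) Kx1.
  have C0 : 0 < Num.sqrt n%:R + 1 :> R by rewrite ltr_wpDl ?sqrtr_ge0.
  have [j xj] := D_dense _ _ (Kx1 0%N) (divr_gt0 e0 C0).
  have [y ymin Dy] := Dw j.
  exists (fun k => traj p (D j) (history (fun k => r1 k w) k)), y; split=> // k.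
  apply: (le_trans (norm_le_enorm _)).
  (* Driven by the same indices, the two paths never move apart, so their initial distance bounds
     all later ones. *)
  apply: (@le_trans _ _ (enorm (x1 0%N w - D j))).
    elim: k => //= k; apply: le_trans.
    apply: (prox_step_nonexpansive alpha0 (b0 k) (x1_step k)).
    rewrite size_history; apply: (p_step).
    by apply: (traj_mem K alpha phi b p p_step).
  rewrite (le_trans (enorm_le_norm _)) //.
  apply: (@le_trans _ _ ((Num.sqrt n%:R + 1) * `|x1 0%N w - D j|)).
    by rewrite ler_wpM2r // lerDl.
  by rewrite -ler_pdivlMl // mulrC ltW.
exists y; split; first exact/argminE.
by rewrite -cvg_shiftS.
Qed.
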